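(* Let $(E,\lVert\cdot\rVert_E)$ be a Banach space and let $\nu\in(0,1)$. Let $f:\mathbb{R}^d\to E$ be a strongly measurable function and let $Q^0\subset\mathbb{R}^d$ be a cube. Then there exists a collection $\mathcal{S}$ of dyadic subcubes of $Q^0$ such that $\mathcal{S}$ is pairwise nearly disjoint with the parameter $\nu$ and, for almost every $x\in Q^0$ and for every quasi-optimal center of oscillation $c_{1/4}(f;Q^0)$ of $f$ on $Q^0$ with a $\frac14$-portion disregarded, $$\lVert f(x)-c_{1/4}(f;Q^0)\rVert_E\le 12\sum_{Q\in\mathcal{S}}\omega_{(1-\nu)2^{-d-2}}(f;Q)\,1_Q(x).$$
   Context: $|\cdot|$ is Lebesgue measure on $\mathbb{R}^d$. Cubes are axis-parallel and half-open. The dyadic subcubes of $Q^0$ are $Q^0$ itself and the cubes obtained by repeatedly dividing it into $2^d$ congruent half-open subcubes. Strong measurability: $f:\mathbb{R}^d\to E$ is strongly (Bochner) measurable if $f^{-1}(B)$ is Lebesgue measurable for every Borel set $B\subset E$ and there is a null set $N$ such that $f(\mathbb{R}^d\setminus N)$ is separable. $B_E(c,r)$ is the closed ball in $E$ with center $c$ and radius $r$. For measurable $f:\mathbb{R}^d\to E$, a cube $Q$ and $0<\lambda<\frac12$, the local oscillation of $f$ on $Q$ with a $\lambda$-portion disregarded is $$\omega_\lambda(f;Q)=\inf_{c\in E}\ \min\Bigl\{r\ge0:\frac{|\{x\in Q: f(x)\notin B_E(c,r)\}|}{|Q|}\le\lambda\Bigr\}.$$ A quasi-optimal center of oscillation of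 $f$ on $Q$ with a $\lambda$-portion disregarded, denoted $c_\lambda(f;Q)$, is any vector $c\in E$ with $$\min\Bigl\{r\ge0:\frac{|\{x\in Q: f(x)\notin B_E(c,r)\}|}{|Q|}\le\lambda\Bigr\}\le2\,\omega_\lambda(f;Q).$$ Pairwise nearly disjoint with the parameter $\nu$: for every $Q\in\mathcal{S}$ there is a measurable subset $E(Q)\subset Q$ with $|E(Q)|\ge\nu|Q|$, and $E(Q)\cap E(Q')=\emptyset$ for all $Q,Q'\in\mathcal{S}$ with $Q\ne Q'$. *)

(* Defs.v *)
From HB Require Import structures.
From mathcomp Require Import all_boot all_order all_algebra.
From mathcomp Require Import all_classical all_reals all_analysis.

Set Implicit Arguments.
Unset Strict Implicit.
Unset Printing Implicit Defensive.

Import Order.TTheory GRing.Theory Num.Theory.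
Import numFieldNormedType.Exports.
Local Open Scope classical_set_scope.
Local Open Scope ring_scope.

Definition box (R : realType) (d : nat) (a b : 'rV[R]_d) : set 'rV[R]_d :=
  [set x | forall i, a 0 i <= x 0 i < b 0 i].

(* The truncation at 0 gives volume 0 to an empty box (when d > 0). *)
Definition box_volume (R : realType) (d : nat) (a b : 'rV[R]_d) : R :=
  \prod_(i < d) Num.max 0 (b 0 i - a 0 i).

(* Lebesgue outer measure on R^d for d > 0, the infimum over countable covers
   by half-open boxes. Lebesgue measurable sets are its Caratheodory measurable
   sets [lebesgue_outer.-caratheodory], and it is Lebesgue measure on them.
   For d = 0 the formula would give mass 1 to the empty set. *)
Definition lebesgue_outer (R : realType) (d : nat) (A : set 'rV[R]_d) : \bar R :=
  ereal_inf [set v | exists a b : nat -> 'rV[R]_d,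
    A `<=` \bigcup_k box (a k) (b k) /\
    v = (\sum_(0 <= k <oo) (box_volume (a k) (b k))%:E)%E].

Definition cube (R : realType) (d : nat) (a : 'rV[R]_d) (l : R) :
    set 'rV[R]_d :=
  box a (a + const_mx l).

Definition is_cube (R : realType) (d : nat) (Q : set 'rV[R]_d) : Prop :=
  exists a : 'rV[R]_d, exists2 l : R, 0 < l & Q = cube a l.

(* The choices of e index the 2^d subcubes of side l / 2 of [cube a l]. *)
Inductive dyadic_subcube (R : realType) (d : nat) (Q0 : set 'rV[R]_d) :
    set 'rV[R]_d -> Prop :=
| dyadic_self : dyadic_subcube Q0 Q0
| dyadic_child (a : 'rV[R]_d) (l : R) (e : 'I_d -> bool) :
    0 < l -> dyadic_subcube Q0 (cube a l) ->
    dyadic_subcube Q0 (cube (a + \row_i (if e i then l / 2 else 0)) (l / 2)).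

Definition separable_set (T : topologicalType) (A : set T) : Prop :=
  exists D : set T, [/\ countable D, D `<=` A & A `<=` closure D].

Definition strongly_measurable (R : realType) (d : nat)
    (E : completeNormedModType R) (f : 'rV[R]_d -> E) : Prop :=
  (forall B : set E, <<s [set U : set E | open U] >> B ->
     (@lebesgue_outer R d).-caratheodory (f @^-1` B)) /\
  (exists N : set 'rV[R]_d,
     lebesgue_outer N = 0%E /\ separable_set (f @` (~` N))).

Section Oscillation.
Context (R : realType) (d : nat) (E : completeNormedModType R).
Implicit Types (lambda : R) (f : 'rV[R]_d -> E) (Q : set 'rV[R]_d) (c : E).

(* [closed_ball_ Num.norm c r] is {y | `|c - y| <= r}, hence {c} for r = 0,
   whereas the library's [closed_ball c 0] is empty. For measurable f, a cube Q
   and 0 < lambda the set below is nonempty and contains its infimum (continuity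
   of measure from below as s decreases to r), so that [inf] is a minimum. *)
Definition oscillation_radius lambda f Q c : R :=
  inf [set r : R | 0 <= r /\
    (lebesgue_outer [set x | Q x /\ ~ closed_ball_ Num.norm c r (f x)]
       / lebesgue_outer Q <= lambda%:E)%E].

Definition oscillation lambda f Q : R :=
  inf [set oscillation_radius lambda f Q c | c in [set: E]].

Definition quasi_optimal_center lambda f Q c : Prop :=
  oscillation_radius lambda f Q c <= 2 * oscillation lambda f Q.

End Oscillation.

Definition nearly_disjoint (R : realType) (d : nat) (nu : R)
    (S : set (set 'rV[R]_d)) : Prop :=
  exists F : set 'rV[R]_d -> set 'rV[R]_d,
    (forall Q, S Q ->
       [/\ (@lebesgue_outer R d).-caratheodory (F Q), F Q `<=` Q &
           (nu%:E * lebesgue_outer Q <= lebesgue_outer (F Q))%E]) /\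
    (forall Q Q', S Q -> S Q' -> Q <> Q' -> F Q `&` F Q' = set0).

(* Main.v *)
Require Import Defs.
From HB Require Import structures.
From mathcomp Require Import all_boot all_order all_algebra.
From mathcomp Require Import all_classical all_reals all_analysis.
From mathcomp Require Import ring lra.
Set Implicit Arguments.
Unset Strict Implicit.
Unset Printing Implicit Defensive.
Import Order.TTheory GRing.Theory Num.Theory.
Import numFieldNormedType.Exports.
Local Open Scope classical_set_scope.
Local Open Scope ring_scope.

(** The theorem follows from a stopping-time argument on the dyadic tree of [Q0].
    Let [t = 2 ^- (d + 2)] and [lam = (1 - nu) * t]. Each dyadic cube [Q] has a
    center [c] and a radius [r <= 2 * oscillation lam f Q] such that [f] leaves the
    ball [B(c, r)] on a bad set of measure at most [lam * |Q|]
    ([exists_quasi_optimal_center], [far_oscillation_radius]).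

    Starting from [Q0], one selects inside a selected cube the maximal dyadic
    subcubes of which more than the portion [t] is bad for that cube, and repeats.
    These subcubes are disjoint and their total measure is at most
    [lam / t = 1 - nu] times that of the cube ([stopping_children_small]), so the
    cube minus its selected subcubes, its core, has the share [nu]
    ([core_large]); the cores make the family nearly disjoint.

    By maximality the parent of a newly selected cube is at most [t]-bad, so the
    cube itself is at most [2 ^ d * t = 1/4]-bad, and the old and the new ball meet:
    consecutive centers differ by at most the sum of the two radii
    ([center_step]). On a core, no small dyadic cube is more than [t]-bad, so
    almost every point of the core is good ([core_bad_null], which rests on the
    density lemma [sparse_null]). The measures of the selected cubes have a finite
    sum, hence almost every point lies in finitely many of them and belongs to the
    core of the last one ([ae_exists_core]). Summing the steps from this core up to
    [Q0] gives [`|f x - c| <= 4 * sum r <= 8 * sum oscillation]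
    ([center_chain], [pointwise_domination]), within the constant [12].

    The measure theory behind this is that boxes are Caratheodory measurable and
    that the outer measure is translation invariant, so the children of a cube
    share its measure equally ([lebesgue_outer_child]). If [Q0] is null, the empty
    family works with [Q0] as exceptional set; otherwise all its dyadic subcubes
    have positive finite measure. *)

(** * Lebesgue outer measure: subadditivity, measurable boxes, dyadic division *)

Section outer.
Context (R : realType) (d : nat).
Implicit Types (a b : 'rV[R]_d.+1) (A : set 'rV[R]_d.+1).
Local Notation mu := (@lebesgue_outer R d.+1).

Lemma box_volume_ge0 a b : 0 <= box_volume a b.
Proof. by apply: prodr_ge0 => i _; rewrite le_max lexx. Qed.

Lemma lebesgue_outer_le_sum A (a b : nat -> 'rV[R]_d.+1) :
  A `<=` \bigcup_k box (a k) (b k) ->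
  (mu A <= \sum_(0 <= k <oo) (box_volume (a k) (b k))%:E)%E.
Proof. by move=> Aab; apply: ereal_inf_lbound; exists a, b. Qed.

Lemma lebesgue_outer_ge0 A : (0 <= mu A)%E.
Proof.
apply: le_ereal_inf_tmp => _ [a [b [_ ->]]].
by apply: nneseries_ge0 => k _ _; rewrite lee_fin box_volume_ge0.
Qed.

Lemma box_volume_diag a : box_volume a a = 0.
Proof. by apply/eqP/prodf_eq0; exists ord0 => //; rewrite subrr maxxx. Qed.

Lemma lebesgue_outer_box_le a b : (mu (box a b) <= (box_volume a b)%:E)%E.
Proof.
apply: le_trans (lebesgue_outer_le_sum (a := fun k => if k is 0%N then a else 0)
    (b := fun k => if k is 0%N then b else 0) _) _.
  by move=> x abx; exists 0%N.
rewrite nneseries_recl//; last by move=> k; rewrite lee_fin box_volume_ge0.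
rewrite eseries_cond/= eseries0 ?adde0// => -[|k]//= _ _.
by rewrite box_volume_diag.
Qed.

Lemma lebesgue_outer0 : mu set0 = 0%E.
Proof.
apply/le_anti; rewrite lebesgue_outer_ge0 andbT.
apply: le_trans (lebesgue_outer_le_sum (a := fun=> 0) (b := fun=> 0) _) _ => //.
by rewrite eseries0// => k _ _; rewrite box_volume_diag.
Qed.

Lemma le_lebesgue_outer : {homo mu : A B / A `<=` B >-> (A <= B)%E}.
Proof.
move=> A B AB; apply/ereal_inf_le_tmp => _ [a [b [Bab ->]]].
by exists a, b; split => //; exact: subset_trans Bab.
Qed.

Lemma lebesgue_outer_adherent A (e : R) : 0 < e -> (mu A < +oo)%E ->
  exists a b : nat -> 'rV[R]_d.+1, A `<=` \bigcup_k box (a k) (b k) /\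
    (\sum_(0 <= k <oo) (box_volume (a k) (b k))%:E <= mu A + e%:E)%E.
Proof.
move=> e0 Aoo; have fA : mu A \is a fin_num by rewrite ge0_fin_numE ?lebesgue_outer_ge0.
have [_ [a [b [Aab ->]]] abe] := lb_ereal_inf_adherent e0 fA.
by exists a, b; split => //; exact: ltW.
Qed.

(** Covers of the [A n] that are optimal up to [e / 2 ^ n.+1] are merged into one
    cover of the union by means of a bijection between [nat] and [nat * nat]. *)
Lemma lebesgue_outer_sigma_subadditive : sigma_subadditive mu.
Proof.
move=> A; have [[i ioo]|] := pselect (exists i, mu (A i) = +oo%E).
  rewrite (eseries_pinfty _ _ ioo) ?leey// => n _.
  by rewrite -ltNye (lt_le_trans _ (lebesgue_outer_ge0 _)).
rewrite -forallNE => Aoo; apply/lee_addgt0Pr => e e0.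
rewrite (le_trans _ (epsilon_trick _ _ _))//; last 2 first.
- by move=> n; exact: lebesgue_outer_ge0.
- exact: ltW.
have /choice[ab abP] : forall n, exists ab : nat -> 'rV[R]_d.+1 * 'rV[R]_d.+1,
    A n `<=` \bigcup_k box (ab k).1 (ab k).2 /\
    (\sum_(0 <= k <oo) (box_volume (ab k).1 (ab k).2)%:E <=
      mu (A n) + (e / (2 ^ n.+1)%:R)%:E)%E.
  move=> n; have [||] := @lebesgue_outer_adherent (A n) (e / (2 ^ n.+1)%:R).
  - by rewrite divr_gt0// ltr0n expn_gt0.
  - by rewrite ltey; exact/eqP/Aoo.
  by move=> a [b [? ?]]; exists (fun k => (a k, b k)).
have /card_esym/ppcard_eqP[g] := card_nat2.
pose p k := ab (g k).1 (g k).2.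
have Ap : \bigcup_n A n `<=` \bigcup_k box (p k).1 (p k).2.
  move=> t [i _ /(abP i).1[j _ tij]]; exists (g^-1%FUN (i, j)) => //=.
  by rewrite /p invK ?inE.
apply: (le_trans (lebesgue_outer_le_sum Ap)).
pose v (ij : nat * nat) := (box_volume (ab ij.1 ij.2).1 (ab ij.1 ij.2).2)%:E.
have v0 ij : (0 <= v ij)%E by rewrite lee_fin box_volume_ge0.
rewrite nneseries_esumT//; last by move=> k; exact: (v0 (g k)).
rewrite (_ : \esum_(i in _) _ = \esum_(ij in [set: nat * nat]) v ij)%E; last first.
  by rewrite (reindex_esum setT setT g).
rewrite (_ : setT = [set: nat] `*`` fun=> [set: nat]); last first.
  by apply/seteqP; split.
rewrite -(@esum_esum _ _ _ _ _ (fun i j => v (i, j)))//.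
rewrite nneseries_esumT; last by move=> k; rewrite adde_ge0 ?lebesgue_outer_ge0// lee_fin divr_ge0// ltW.
apply: le_esum => i _; rewrite -nneseries_esumT//; exact: (abP i).2.
Qed.

HB.instance Definition _ := isOuterMeasure.Build R 'rV[R]_d.+1 mu
  lebesgue_outer0 lebesgue_outer_ge0 le_lebesgue_outer
  lebesgue_outer_sigma_subadditive.

End outer.

Local Notation cmeasurable :=
  (@measurable _ (caratheodory_type (@lebesgue_outer _ _.+1))).

Section lebesgue.
Context (R : realType) (d : nat).
Implicit Types (a b v : 'rV[R]_d.+1) (A : set 'rV[R]_d.+1).
Local Notation mu := (@lebesgue_outer R d.+1).

Lemma lebesgue_outer_translate_le v A :
  (mu [set x | A (x - v)%R] <= mu A)%E.
Proof.
apply/ereal_inf_le_tmp => _ [a [b [Aab ->]]].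
exists (fun k => a k + v), (fun k => b k + v); split.
  move=> x /Aab[k _ xk]; exists k => // i.
  by move: (xk i); rewrite !mxE lerBrDr ltrBlDr.
apply: eq_eseriesr => k _; congr EFin; apply: eq_bigr => i _; rewrite !mxE.
by congr Num.max; ring.
Qed.

Lemma lebesgue_outer_cube_translate a v (l : R) :
  mu (cube (a + v)%R l) = mu (cube a l).
Proof.
have shift (u w : 'rV[R]_d.+1) : cube (u + w) l = [set x | cube u l (x - w)%R].
  apply/seteqP; split => x /= + i; move=> /(_ i); rewrite !mxE.
    by move=> /andP[? ?]; apply/andP; split; lra.
  by move=> /andP[? ?]; apply/andP; split; lra.
apply/le_anti/andP; split; first by rewrite shift lebesgue_outer_translate_le.
by rewrite -[in leLHS](addrK v a) (shift (a + v) (- v)) lebesgue_outer_translate_le.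
Qed.

Definition halfspace (i : 'I_d.+1) (c : R) : set 'rV[R]_d.+1 :=
  [set x | x 0 i < c].

Definition set_coord a (i : 'I_d.+1) (c : R) : 'rV[R]_d.+1 :=
  \row_j if j == i then c else a 0 j.

Lemma max0_split (a b c : R) :
  Num.max 0 (b - a) =
  Num.max 0 (Num.min b c - a) + Num.max 0 (b - Num.max a c).
Proof. by case: (leP b c) => ?; case: (leP a c) => ?; do ![case: leP => ?]; lra. Qed.

(** If [c] lies outside the interval of the [i]-th coordinates, one of the two
    boxes on the right is empty and the truncation in [box_volume] discards it. *)
Lemma box_volume_split a b i c :
  box_volume a b = box_volume a (set_coord b i (Num.min (b 0 i) c)) +
    box_volume (set_coord a i (Num.max (a 0 i) c)) b.
Proof.
rewrite /box_volume (bigD1 i)//= (max0_split _ _ c) mulrDl.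
rewrite [X in _ = X + _](bigD1 i)//= [X in _ = _ + X](bigD1 i)//=.
congr (_ * _ + _ * _); [by rewrite mxE eqxx| |by rewrite mxE eqxx|].
  by apply: eq_bigr => j /negbTE ji; rewrite mxE ji.
by apply: eq_bigr => j /negbTE ji; rewrite mxE ji.
Qed.

(** A coordinate hyperplane cuts every box of a cover into two boxes whose volumes
    add up, so it also splits the infimum over covers. *)
Lemma halfspace_caratheodory i c : mu.-caratheodory (halfspace i c).
Proof.
apply: le_caratheodory_measurable => X; apply: le_ereal_inf_tmp.
move=> _ [a [b [Xab ->]]].
rewrite (eq_eseriesr (g := fun k => (box_volume (a k) (set_coord (b k) i
    (Num.min (b k 0 i) c)))%:E + (box_volume (set_coord (a k) i
    (Num.max (a k 0 i) c)) (b k))%:E)%E); last first.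
  by move=> k _; rewrite (box_volume_split _ _ i c).
rewrite nneseriesD; last 2 first.
- by move=> k _ _; rewrite lee_fin box_volume_ge0.
- by move=> k _ _; rewrite lee_fin box_volume_ge0.
apply: leeD; apply: lebesgue_outer_le_sum => x [/Xab[k _ xk] /=].
  move=> xc; exists k => // j; rewrite mxE; case: eqP => [->|_]; last exact: xk.
  by have /andP[-> xb] := xk i; rewrite lt_min xb.
move=> /negP; rewrite -leNgt => xc.
exists k => // j; rewrite mxE; case: eqP => [->|_]; last exact: xk.
by have /andP[xb ->] := xk i; rewrite ge_max xb xc.
Qed.

(** Lemmas on measures apply to this form of [lebesgue_outer], and their
    conclusions convert back to it. *)
Definition lebesgue :
    {measure set (caratheodory_type (@lebesgue_outer R d.+1)) -> \bar R} :=
  let m : {outer_measure set 'rV[R]_d.+1 -> \bar R} := @lebesgue_outer R d.+1 in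
  (m : set (caratheodory_type m) -> \bar R).

Lemma measurable_box a b : cmeasurable (box a b).
Proof.
rewrite (_ : box a b = \bigcap_(i in [set: 'I_d.+1])
    (halfspace i (b 0 i) `\` halfspace i (a 0 i))).
  apply: fin_bigcap_measurable => // i _.
  by apply: measurableD; exact: halfspace_caratheodory.
apply/seteqP; split => [x xab i _|x xab i].
  by have /andP[xa xb] := xab i; split => //=; apply/negP; rewrite -leNgt.
by have [//|xb /negP] := xab i; rewrite -leNgt => ->.
Qed.

Lemma lebesgue_outer_box_lty a b : (mu (box a b) < +oo)%E.
Proof. by rewrite (le_lt_trans (lebesgue_outer_box_le a b))// ltry. Qed.

Definition child_corner a (l : R) (e : 'I_d.+1 -> bool) : 'rV[R]_d.+1 :=
  a + \row_i (if e i then l / 2 else 0).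

Lemma child_cube_sub a l e : 0 < l ->
  cube (child_corner a l e) (l / 2) `<=` cube a l.
Proof.
move=> l0 x xe i; move: (xe i); rewrite !mxE.
by case: ifP => _ /andP[? ?]; apply/andP; split; lra.
Qed.

Lemma child_cube_cover a l x : cube a l x ->
  exists e : {ffun 'I_d.+1 -> bool}, cube (child_corner a l e) (l / 2) x.
Proof.
move=> xa; exists [ffun i => a 0 i + l / 2 <= x 0 i] => i.
move: (xa i); rewrite !mxE ffunE.
by case: ifPn; rewrite -?ltNge => ? /andP[? ?]; apply/andP; split; lra.
Qed.

Lemma child_cube_inj a l (e e' : {ffun 'I_d.+1 -> bool}) x :
  cube (child_corner a l e) (l / 2) x -> cube (child_corner a l e') (l / 2) x ->
  e = e'.
Proof.
move=> xe xe'; apply/ffunP => i; move: (xe i) (xe' i); rewrite !mxE.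
by case: (e i); case: (e' i) => // /andP[? ?] /andP[? ?]; exfalso; lra.
Qed.

(** The children of a cube are pairwise disjoint translates of one another and
    additivity on Caratheodory sets gives each of them the share [2 ^- d.+1]. *)
Lemma lebesgue_outer_child a l (e : 'I_d.+1 -> bool) : 0 < l ->
  mu (cube a l) =
  ((2 ^+ d.+1)%:E * mu (cube (child_corner a l e) (l / 2)))%E.
Proof.
move=> l0.
have -> : cube a l = \bigcup_(e in [set: {ffun 'I_d.+1 -> bool}])
    cube (child_corner a l e) (l / 2).
  apply/seteqP; split => [x /child_cube_cover[e' xe']|x [e' _]]; first by exists e'.
  exact: child_cube_sub.
have disj : trivIset [set: {ffun 'I_d.+1 -> bool}]
    (fun e => cube (child_corner a l e) (l / 2)).
  by move=> e1 e2 _ _ [x [x1 x2]]; exact: (child_cube_inj x1 x2).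
rewrite [LHS](measure_fin_bigcup lebesgue _ disj)//=; last first.
  by move=> e' _; exact: measurable_box.
rewrite (eq_fsbigr (fun=> mu (cube a (l / 2)))); last first.
  by move=> e' _; exact: lebesgue_outer_cube_translate.
rewrite lebesgue_outer_cube_translate.
have -> : [set: {ffun 'I_d.+1 -> bool}] = [set` enum {ffun 'I_d.+1 -> bool}].
  by apply/seteqP; split => // e' _ /=; rewrite mem_enum.
rewrite -fsbig_seq ?enum_uniq//.
rewrite big_enum /= big_const card_ffun card_bool card_ord.
rewrite -natrX mule_natl.
by elim: (2 ^ d.+1)%N => [|n IH]; rewrite ?mule0n // muleS iterS IH.
Qed.

End lebesgue.

(** * The dyadic cubes, indexed by words *)

Section dyadic.
Context (R : realType) (d : nat) (a0 : 'rV[R]_d.+1) (l0 : R).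
Hypothesis l0_gt0 : 0 < l0.
Local Notation mu := (@lebesgue_outer R d.+1).
Local Notation word := (seq {ffun 'I_d.+1 -> bool}).
Implicit Types (u w : word).

Definition side w : R := l0 / 2 ^+ size w.

(** A word lists the successive choices of a child, the most recent one first, so
    that passing to the parent cube is taking the tail. Ancestry among cubes is
    then the suffix relation [w = u ++ v] among words. *)
Fixpoint corner w : 'rV[R]_d.+1 :=
  if w is e :: w' then child_corner (corner w') (side w') e else a0.

Definition dcube w : set 'rV[R]_d.+1 := cube (corner w) (side w).

Lemma side_gt0 w : 0 < side w.
Proof. by rewrite divr_gt0// exprn_gt0. Qed.

Lemma side_cons e w : side (e :: w) = side w / 2.
Proof. by rewrite /side /= exprSr invfM mulrA. Qed.

Lemma dcube_cons e w :
  dcube (e :: w) = cube (child_corner (corner w) (side w) e) (side w / 2).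
Proof. by rewrite /dcube side_cons. Qed.

Lemma dcube0 : dcube [::] = cube a0 l0.
Proof. by rewrite /dcube /side expr0 divr1. Qed.

Lemma dyadic_dcube w : dyadic_subcube (cube a0 l0) (dcube w).
Proof.
elim: w => [|e w IH]; first by rewrite dcube0; exact: dyadic_self.
by rewrite dcube_cons; apply: dyadic_child => //; exact: side_gt0.
Qed.

Lemma dcube_cat_sub u w : dcube (u ++ w) `<=` dcube w.
Proof.
elim: u => [//|e u IH] /=; apply: subset_trans IH.
by rewrite dcube_cons; exact: child_cube_sub (side_gt0 _).
Qed.

Lemma dcube_cover w x : dcube w x -> exists e, dcube (e :: w) x.
Proof. by move=> /child_cube_cover[e xe]; exists e; rewrite dcube_cons. Qed.

Lemma dcube_cover_size n x : cube a0 l0 x -> exists2 w, size w = n & dcube w x.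
Proof.
move=> x0; elim: n => [|n [w wn /dcube_cover[e xe]]].
  by exists [::] => //; rewrite dcube0.
by exists (e :: w) => //=; rewrite wn.
Qed.

Lemma dcube_inj u w x : size u = size w -> dcube u x -> dcube w x -> u = w.
Proof.
elim: u w => [[]//|e u IH [//|e' w] /= [/IH{}IH]] xu xw.
have uw := IH (@dcube_cat_sub [:: e] u _ xu) (@dcube_cat_sub [:: e'] w _ xw).
by move: xu xw; rewrite uw !dcube_cons => /child_cube_inj /[apply] ->.
Qed.

Lemma dcube_nested u w x : (size u <= size w)%N -> dcube u x -> dcube w x ->
  exists v, w = v ++ u.
Proof.
move=> uw xu xw; exists (take (size w - size u) w).
rewrite -[LHS](cat_take_drop (size w - size u)); congr cat.
apply/esym/(dcube_inj _ xu); first by rewrite size_drop subKn.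
by apply: (@dcube_cat_sub (take (size w - size u) w)); rewrite cat_take_drop.
Qed.

Lemma measurable_dcube w : cmeasurable (dcube w).
Proof. exact: measurable_box. Qed.

Lemma dcube_lty w : (mu (dcube w) < +oo)%E.
Proof. exact: lebesgue_outer_box_lty. Qed.

Lemma dcube_fin w : mu (dcube w) \is a fin_num.
Proof. by rewrite ge0_fin_numE ?lebesgue_outer_ge0// dcube_lty. Qed.

Lemma lebesgue_outer_dcube_cons e w :
  mu (dcube w) = ((2 ^+ d.+1)%:E * mu (dcube (e :: w)))%E.
Proof.
by rewrite dcube_cons; exact: lebesgue_outer_child (side_gt0 _).
Qed.

Hypothesis Q0_gt0 : (0 < mu (cube a0 l0))%E.

Lemma dcube_gt0 w : (0 < mu (dcube w))%E.
Proof.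
elim: w => [|e w]; first by rewrite dcube0.
by rewrite (lebesgue_outer_dcube_cons e) pmule_rgt0// lte_fin exprn_gt0.
Qed.

Lemma lebesgue_outer_dcube_cons_lt e w : (mu (dcube (e :: w)) < mu (dcube w))%E.
Proof.
rewrite (lebesgue_outer_dcube_cons e w).
have := dcube_gt0 (e :: w); rewrite -(fineK (dcube_fin (e :: w))).
rewrite -EFinM !lte_fin => m0.
by rewrite ltr_pMl// exprn_egt1 ?ltr1n.
Qed.

(** The sum in the theorem ranges over sets, so the ancestors of a cube must be
    distinct as sets; the strictly decreasing measures tell them apart. *)
Lemma dcube_size_neq u w :
  (size u < size w)%N -> dcube u = dcube w -> False.
Proof.
move=> uw Euw.
have [x xu] : dcube u !=set0.
  apply/set0P/eqP => u0; have := dcube_gt0 u.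
  by rewrite u0 lebesgue_outer0 ltxx.
have xw : dcube w x by rewrite -Euw.
have [[|e v] wE] := dcube_nested (ltnW uw) xu xw.
  by move: uw; rewrite wE ltnn.
have : (mu (dcube w) < mu (dcube u))%E.
  rewrite wE; apply: lt_le_trans (lebesgue_outer_dcube_cons_lt e (v ++ u)) _.
  by apply: le_lebesgue_outer; exact: dcube_cat_sub.
by rewrite Euw ltxx.
Qed.

End dyadic.

(** * Comparing measures piece by piece *)

Section countable_family.
Context (R : realType) (d : nat) (I : countType).
Local Notation mu := (@lebesgue_outer R d.+1).
Implicit Types (P : set I) (A : I -> set 'rV[R]_d.+1) (X Y : set 'rV[R]_d.+1).

(** Series of measures and countable additivity are about sequences, so families
    over a countable type are reindexed by [nat]. *)
Definition pickled P A (k : nat) : set 'rV[R]_d.+1 :=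
  [set x | exists i, [/\ P i, pickle i = k & A i x]].

Lemma bigcup_pickled P A : \bigcup_k pickled P A k = \bigcup_(i in P) A i.
Proof.
apply/seteqP; split => [x [_ _ [i [Pi _ Aix]]]|x [i Pi Aix]]; first by exists i.
by exists (pickle i) => //; exists i.
Qed.

Lemma pickledP P A k : pickled P A k = set0 \/
  exists2 i, P i & pickle i = k /\ (forall B, pickled P B k = B i).
Proof.
have [[i [Pi ik]]|no] := pselect (exists i, P i /\ pickle i = k).
  right; exists i => //; split => // B.
  apply/seteqP; split => [x [j [_ jk Bjx]]|x Bix]; last by exists i.
  by rewrite -(pcan_inj pickleK (etrans jk (esym ik))).
by left; rewrite -subset0 => x [i [Pi ik _]]; apply: no; exists i.
Qed.

Lemma measurable_pickled P A : (forall i, P i -> cmeasurable (A i)) ->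
  forall k, cmeasurable (pickled P A k).
Proof.
move=> mA k; have [->|[i Pi [_ ->]]] := pickledP P A k; first exact: measurable0.
exact: mA.
Qed.

Lemma trivIset_pickled P A : trivIset P A -> trivIset setT (pickled P A).
Proof.
move=> tA k k' _ _ [x [[i [Pi <- Aix]] [j [Pj <- Ajx]]]].
by rewrite (tA i j Pi Pj)//; exists x.
Qed.

Lemma measurable_bigcup_countType P A : (forall i, P i -> cmeasurable (A i)) ->
  cmeasurable (\bigcup_(i in P) A i).
Proof.
by move=> /measurable_pickled mA; rewrite -bigcup_pickled; exact: bigcupT_measurable.
Qed.

Lemma lebesgue_outer_bigcup_null P A : (forall i, P i -> mu (A i) = 0%E) ->
  mu (\bigcup_(i in P) A i) = 0%E.
Proof.
move=> A0; rewrite -bigcup_pickled; apply/le_anti; rewrite lebesgue_outer_ge0 andbT.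
apply: le_trans (lebesgue_outer_sigma_subadditive _) _.
rewrite eseries0// => k _ _; have [->|[i Pi [_ ->]]] := pickledP P A k.
  exact: lebesgue_outer0.
exact: A0.
Qed.

Lemma caratheodory_sum_le P A X : (forall i, P i -> cmeasurable (A i)) ->
  trivIset P A ->
  (\sum_(0 <= k <oo) mu (X `&` pickled P A k) <= mu (X `&` \bigcup_(i in P) A i))%E.
Proof.
move=> mA tA.
have /(_ (X `&` \bigcup_(i in P) A i)) := caratheodory_lime_le
  (measurable_pickled mA) (trivIset_pickled tA).
rewrite bigcup_pickled -[X in (_ + mu X)%E]setIA setICr setI0 lebesgue_outer0 adde0.
rewrite (eq_eseriesr (g := fun k => mu (X `&` pickled P A k)))// => k _.
congr mu; rewrite -setIA; congr (_ `&` _); apply/setIidr.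
by rewrite -bigcup_pickled; exact: bigcup_sup.
Qed.

(** Countable subadditivity on the left and countable additivity on the right let
    a bound on each piece pass to the union. *)
Lemma piecewise_le P A X Y (c : R) : 0 <= c ->
  (forall i, P i -> cmeasurable (A i)) -> trivIset P A ->
  (forall i, P i -> (mu (X `&` A i) <= c%:E * mu (Y `&` A i))%E) ->
  (mu (X `&` \bigcup_(i in P) A i) <= c%:E * mu (Y `&` \bigcup_(i in P) A i))%E.
Proof.
move=> c0 mA tA XY; rewrite -[X in (mu (_ `&` X) <= _)%E]bigcup_pickled.
apply: le_trans (outer_measure_bigcup_lim _ _ _) _.
apply: le_trans (lee_wpmul2l _ (caratheodory_sum_le Y mA tA)); last by rewrite lee_fin.
rewrite -nneseriesZl; last by move=> k _; exact: lebesgue_outer_ge0.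
apply: lee_nneseries => k _; first by move=> _; exact: lebesgue_outer_ge0.
have [->|[i Pi [_ E]]] := pickledP P A k; last by rewrite E; exact: XY.
by rewrite !setI0 ?outer_measure0 ?lebesgue_outer0 mule0.
Qed.

End countable_family.

(** * A density lemma *)

Section density.
Context (R : realType) (d : nat) (a0 : 'rV[R]_d.+1) (l0 : R).
Hypothesis l0_gt0 : 0 < l0.
Local Notation mu := (@lebesgue_outer R d.+1).
Local Notation dcube := (dcube a0 l0).

Lemma box_volume_enlarge_cvg (a b : 'rV[R]_d.+1) (h : nat -> R) :
  h @ \oo --> (0 : R) ->
  box_volume (a - const_mx (h n)) (b + const_mx (h n)) @[n --> \oo] -->
    box_volume a b.
Proof.
move=> h0; apply: cvg_big => [|i _]; first exact: mul_continuous.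
under eq_fun do rewrite !mxE maxr_absE.
rewrite maxr_absE.
have hi : (fun n => b 0 i + h n - (a 0 i - h n)) @ \oo --> b 0 i - a 0 i.
  rewrite -[X in _ --> X]addr0 -[X in _ --> _ + X](addr0 0).
  rewrite (_ : (fun _ => _) = (fun n => (b 0 i - a 0 i) + (h n + h n))); last first.
    by apply/funext => n; ring.
  by apply: cvgD; [exact: cvg_cst|exact: cvgD].
apply: cvgM; last exact: cvg_cst.
apply: cvgD; first by apply: cvgD => //; exact: cvg_cst.
by apply: cvg_norm; apply: cvgB => //; exact: cvg_cst.
Qed.

(** The cubes of a fine generation that meet a box stay in a slight enlargement of
    it, so the proportion [t] that holds on cubes passes to the box when the mesh
    tends to [0]. *)
Lemma sparse_box_le (G : set 'rV[R]_d.+1) (n0 : nat) (t : R) : 0 <= t ->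
  G `<=` cube a0 l0 ->
  (forall w, (n0 <= size w)%N -> (mu (G `&` dcube w) <= t%:E * mu (dcube w))%E) ->
  forall a b, (mu (G `&` box a b) <= (t * box_volume a b)%:E)%E.
Proof.
move=> t0 G0 Gw a b.
pose h n := l0 / 2 ^+ n.
have h0 : h @ \oo --> (0 : R).
  have := @cvg_geometric R l0 2^-1; rewrite ger0_norm ?invr_ge0// invf_lt1// ltr1n.
  move=> /(_ isT); rewrite (_ : geometric l0 2^-1 = h)//.
  by apply/funext => n; rewrite /geometric /= exprVn.
have Gfin : mu (G `&` box a b) \is a fin_num.
  rewrite ge0_fin_numE ?lebesgue_outer_ge0//.
  by apply: le_lt_trans (lebesgue_outer_box_lty a b); apply: le_lebesgue_outer; exact: subIsetr.
rewrite -(fineK Gfin) lee_fin.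
have hvol : t * box_volume (a - const_mx (h n)) (b + const_mx (h n)) @[n --> \oo] -->
    t * box_volume a b.
  by apply: cvgM; [exact: cvg_cst|exact: box_volume_enlarge_cvg].
rewrite -(cvg_lim (@Rhausdorff R) hvol); apply: limr_ge.
  by apply/cvg_ex; exists (t * box_volume a b).
near=> n; rewrite -lee_fin fineK//.
pose W := [set w | size w = n /\ dcube w `&` box a b !=set0].
have tW : trivIset W dcube.
  move=> u w [un _] [wn _] [x [xu xw]].
  by apply: dcube_inj xu xw => //; rewrite un wn.
have GW w : W w -> (mu (G `&` dcube w) <= t%:E * mu (setT `&` dcube w))%E.
  move=> [wn _]; rewrite setTI; apply: Gw; rewrite wn.
  by near: n; exists n0.
have := piecewise_le t0 (fun w _ => measurable_dcube a0 l0 w) tW GW.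
rewrite setTI => GU.
apply: (@le_trans _ _ (mu (G `&` \bigcup_(w in W) dcube w))).
  apply: le_lebesgue_outer => x [Gx xab]; split=> //.
  have [w wn xw] := dcube_cover_size n (G0 _ Gx).
  by exists w => //; split=> //; exists x.
apply: (le_trans GU); rewrite EFinM; apply: lee_wpmul2l; first by rewrite lee_fin.
apply: le_trans (lebesgue_outer_box_le _ _); apply: le_lebesgue_outer.
move=> x [w [wn [y [yw yab]]] xw] i; move: (xw i) (yw i) (yab i).
rewrite !mxE /side wn -/(h n) => /andP[? ?] /andP[? ?] /andP[? ?].
by apply/andP; split; lra.
Unshelve. all: by end_near. Qed.

(** A substitute for the Lebesgue density theorem: a set that fills at most the
    proportion [t < 1] of each small dyadic cube satisfies [mu G <= t * v] for the
    total volume [v] of any of its covers by boxes, whence [mu G <= t * mu G]. *)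
Lemma sparse_null (G : set 'rV[R]_d.+1) (n0 : nat) (t : R) : 0 <= t < 1 ->
  G `<=` cube a0 l0 ->
  (forall w, (n0 <= size w)%N -> (mu (G `&` dcube w) <= t%:E * mu (dcube w))%E) ->
  mu G = 0%E.
Proof.
move=> /andP[t0 t1] G0 Gw.
have Goo : (mu G < +oo)%E.
  exact: le_lt_trans (le_lebesgue_outer G0) (lebesgue_outer_box_lty _ _).
have Gfin : mu G \is a fin_num by rewrite ge0_fin_numE ?lebesgue_outer_ge0.
apply/le_anti; rewrite lebesgue_outer_ge0 andbT leNgt.
rewrite -(fineK Gfin) lte_fin; apply/negP => m0; set m := fine _ in m0.
have e0 : 0 < m * (1 - t) / 2 by rewrite divr_gt0// mulr_gt0// subr_gt0.
have [a [b [Gab]]] := lebesgue_outer_adherent e0 Goo.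
have : (mu G <= t%:E * \sum_(0 <= k <oo) (box_volume (a k) (b k))%:E)%E.
  rewrite -[X in (mu X <= _)%E](setIidl Gab).
  apply: le_trans (outer_measure_bigcup_lim _ _ _) _.
  rewrite -nneseriesZl; last by move=> k _; rewrite lee_fin box_volume_ge0.
  apply: lee_nneseries => k _; first by move=> _; exact: lebesgue_outer_ge0.
  by rewrite -EFinM; exact: sparse_box_le Gw _ _.
move=> /le_trans + ab; move=> /(_ _ (lee_wpmul2l _ ab)).
rewrite -(fineK Gfin) -/m -EFinD -EFinM !lee_fin => /(_ t0).
nra.
Qed.

End density.

(** * Quasi-optimal centers of oscillation *)

Section oscillation.
Context (R : realType) (d : nat) (E : completeNormedModType R).
Local Notation mu := (@lebesgue_outer R d.+1).
Local Notation leb := (@lebesgue R d).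
Context (f : 'rV[R]_d.+1 -> E).
Hypothesis measurable_ball : forall c r,
  cmeasurable (f @^-1` (closed_ball_ Num.norm c r)).

(** The set whose share of [Q] is compared with the disregarded portion in
    [oscillation_radius]. *)
Definition far (Q : set 'rV[R]_d.+1) (c : E) (r : R) : set 'rV[R]_d.+1 :=
  [set x | Q x /\ ~ closed_ball_ Num.norm c r (f x)].

Lemma far_sub Q c r : far Q c r `<=` Q.
Proof. by move=> x []. Qed.

Lemma sub_far Q c c' r r' : r + `|c - c'| <= r' -> far Q c' r' `<=` far Q c r.
Proof.
move=> rr' x [Qx nb]; split => // cr; apply: nb; rewrite /closed_ball_/= in cr *.
rewrite (le_trans (ler_distD c _ _))// (le_trans _ rr')//.
by rewrite addrC lerD// distrC.
Qed.

Context (Q : set 'rV[R]_d.+1).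
Hypothesis mQ : cmeasurable Q.
Hypothesis Q_fin : mu Q \is a fin_num.
Hypothesis Q_gt0 : (0 < mu Q)%E.

Lemma measurable_far c r : cmeasurable (far Q c r).
Proof.
rewrite (_ : far Q c r = Q `\` (f @^-1` (closed_ball_ Num.norm c r)))//.
by apply: measurableD => //; exact: measurable_ball.
Qed.

(** [far Q c r] is the increasing union of the sets [far Q c (r + n.+1^-1)], so a
    bound for all larger radii passes to [r]. This makes the infimum in
    [oscillation_radius] a minimum. *)
Lemma far_closed c r (m : \bar R) :
  (forall e, 0 < e -> (mu (far Q c (r + e)) <= m)%E) -> (mu (far Q c r) <= m)%E.
Proof.
move=> em; pose F n := far Q c (r + n.+1%:R^-1).
have FE : far Q c r = \bigcup_n F n.
  apply/seteqP; split => [x [Qx /negP]|x [n _]]; last first.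
    by apply: sub_far; rewrite subrr normr0 addr0 lerDl.
  rewrite /closed_ball_/= -ltNge => rx.
  have [n nx] : exists n, n.+1%:R^-1 < `|c - f x| - r.
    near \oo => n; exists n.
    by near: n; apply: (near_infty_natSinv_lt (PosNum _)); rewrite subr_gt0.
  by exists n => //; split=> //; apply/negP; rewrite /closed_ball_/= -ltNge -ltrBrDl.
have mF n : cmeasurable (F n) by exact: measurable_far.
have Fmono : {homo F : n m / (n <= m)%N >-> (n <= m)%O}.
  move=> n k nk; apply/subsetPset; apply: sub_far.
  by rewrite subrr normr0 addr0 lerD2l lef_pV2 ?posrE// ler_nat.
have := nondecreasing_cvg_mu (mu := @lebesgue R d) mF (bigcupT_measurable _ mF) Fmono.
rewrite -FE => cF; rewrite -[leLHS]/(leb (far Q c r)).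
rewrite -(cvg_lim _ cF)//; apply: lime_le; first by apply/cvg_ex; exists (leb (far Q c r)).
by apply: nearW => n; apply: em; rewrite invr_gt0.
Unshelve. all: by end_near. Qed.

Lemma far_small c (t : R) : 0 < t ->
  exists2 r, 0 <= r & (mu (far Q c r) <= t%:E * mu Q)%E.
Proof.
move=> t0; pose F n := far Q c n%:R.
have F0 : \bigcap_n F n = set0.
  rewrite -subset0 => x Fx; have [_] := Fx (Num.truncn `|c - f x|).+1 Logic.I.
  by apply; rewrite /closed_ball_/= ltW// truncnS_gt.
have mF n : cmeasurable (F n) by exact: measurable_far.
have Fmono : {homo F : n m / (n <= m)%N >-> (m <= n)%O}.
  move=> n k nk; apply/subsetPset; apply: sub_far.
  by rewrite subrr normr0 addr0 ler_nat.
have F0oo : (leb (F 0%N) < +oo)%E.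
  apply: (@le_lt_trans _ _ (mu Q)); first exact: le_lebesgue_outer (@far_sub _ _ _).
  by move: Q_fin; rewrite ge0_fin_numE ?lebesgue_outer_ge0.
have := nonincreasing_cvg_mu F0oo mF (bigcapT_measurable mF) Fmono.
rewrite F0 measure0 => /fine_cvgP[Ffin F_cvg0].
have tQ : 0 < t * fine (mu Q).
  by rewrite mulr_gt0// fine_gt0// Q_gt0 -ge0_fin_numE ?lebesgue_outer_ge0.
near \oo => n; exists n%:R => //.
rewrite -(fineK Q_fin) -EFinM -[leLHS]/(leb (F n)) -[leLHS]fineK; last first.
  by near: n.
rewrite lee_fin ltW//; near: n.
by move/cvgrPdist_lt : F_cvg0 => /(_ _ tQ); apply: filterS => n; rewrite sub0r normrN; apply: le_lt_trans; rewrite ler_norm.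
Unshelve. all: by end_near. Qed.

(** If the portions missed by two balls add up to less than [1], some point of [Q]
    is sent by [f] into both balls. *)
Lemma balls_meet c c' r r' (t t' : R) : t + t' < 1 ->
  (mu (far Q c r) <= t%:E * mu Q)%E -> (mu (far Q c' r') <= t'%:E * mu Q)%E ->
  `|c - c'| <= r + r'.
Proof.
move=> tt' ct ct'; rewrite leNgt; apply/negP => rc.
have : (mu Q <= mu (far Q c r `|` far Q c' r'))%E.
  apply: le_lebesgue_outer => x Qx.
  have [xc|xc] := pselect (closed_ball_ Num.norm c r (f x)); last by left.
  right; split=> // xc'; rewrite /closed_ball_/= in xc xc'; move: rc; apply/negP; rewrite -leNgt.
  by rewrite (le_trans (ler_distD (f x) _ _))// lerD// distrC.
move=> /le_trans/(_ (outer_measureU2 _ _ _))/le_trans/(_ (leeD ct ct')).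
move: Q_gt0; rewrite -(fineK Q_fin) -!EFinM -EFinD !lee_fin lte_fin.
nra.
Qed.

Lemma far_ratio c r (t : R) :
  (mu (far Q c r) / mu Q <= t%:E)%E = (mu (far Q c r) <= t%:E * mu Q)%E.
Proof.
rewrite -(fineK Q_fin) inver gt_eqF ?lee_pdivrMr//.
  by rewrite -lte_fin fineK.
by rewrite -lte_fin fineK.
Qed.

Definition far_radii (t : R) c : set R :=
  [set r | 0 <= r /\ (mu (far Q c r) <= t%:E * mu Q)%E].

Lemma oscillation_radiusE t c : oscillation_radius t f Q c = inf (far_radii t c).
Proof.
rewrite /oscillation_radius; congr inf; apply/seteqP.
by split => r [r0] /=; [rewrite far_ratio|rewrite -far_ratio].
Qed.

Lemma has_inf_far_radii t c : 0 < t -> has_inf (far_radii t c).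
Proof.
move=> t0; split; last by exists 0 => r [].
by have [r r0 ?] := far_small c t0; exists r.
Qed.

Lemma oscillation_radius_ge0 t c : 0 < t -> 0 <= oscillation_radius t f Q c.
Proof.
move=> t0; rewrite oscillation_radiusE.
by apply: lb_le_inf => [|r []//]; exact: (has_inf_far_radii c t0).1.
Qed.

Lemma oscillation_radius_le t c r : 0 <= r ->
  (mu (far Q c r) <= t%:E * mu Q)%E -> oscillation_radius t f Q c <= r.
Proof.
move=> r0 cr; rewrite oscillation_radiusE; apply: ge_inf => //.
by exists 0 => s [].
Qed.

Lemma far_oscillation_radius t c : 0 < t ->
  (mu (far Q c (oscillation_radius t f Q c)) <= t%:E * mu Q)%E.
Proof.
move=> t0; apply: far_closed => e e0; rewrite oscillation_radiusE.
have [r [r0 cr] re] := inf_adherent e0 (has_inf_far_radii c t0).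
apply: le_trans cr; apply: le_lebesgue_outer; apply: sub_far.
by rewrite subrr normr0 addr0 ltW.
Qed.

Lemma has_inf_oscillation t : 0 < t ->
  has_inf [set oscillation_radius t f Q c | c in [set: E]].
Proof.
move=> t0; split; first by exists (oscillation_radius t f Q 0), 0.
by exists 0 => _ [c _ <-]; exact: oscillation_radius_ge0.
Qed.

Lemma oscillation_ge0 t : 0 < t -> 0 <= oscillation t f Q.
Proof.
move=> t0; apply: lb_le_inf; first exact: (has_inf_oscillation t0).1.
by move=> _ [c _ <-]; exact: oscillation_radius_ge0.
Qed.

Lemma oscillation_le_radius t c : 0 < t ->
  oscillation t f Q <= oscillation_radius t f Q c.
Proof.
by move=> t0; apply: ge_inf; [exact: (has_inf_oscillation t0).2|exists c].
Qed.

(** For a positive oscillation the factor [2] leaves room for a near-minimizer. If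
    the oscillation is [0], centers with radii tending to [0] form a Cauchy
    sequence, because their balls meet pairwise when [t < 1/2]; by completeness of
    [E] they converge, and the limit has radius [0]. *)
Lemma exists_quasi_optimal_center (t : R) : 0 < t -> t < 2^-1 ->
  exists c, quasi_optimal_center t f Q c.
Proof.
move=> t0 t12; rewrite /quasi_optimal_center.
have half_gt0 (e : R) : 0 < e -> 0 < e / 2 by move=> e0; rewrite divr_gt0.
have := oscillation_ge0 t0; rewrite le_eqVlt => /predU1P[w0|w0]; last first.
  have [_ [c _ <-]] := inf_adherent w0 (has_inf_oscillation t0).
  by rewrite -/(oscillation t f Q) => cw; exists c; lra.
have /choice[c cP] n : exists c, oscillation_radius t f Q c < n.+1%:R^-1.
  have n0 : 0 < n.+1%:R^-1 :> R by rewrite invr_gt0.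
  have [_ [c _ <-]] := inf_adherent n0 (has_inf_oscillation t0).
  by rewrite -/(oscillation t f Q) -w0 add0r => cw; exists c.
have cc n m : `|c n - c m| <= n.+1%:R^-1 + m.+1%:R^-1.
  have tt : t + t < 1 by lra.
  apply: le_trans (balls_meet tt (far_oscillation_radius (c n) t0)
    (far_oscillation_radius (c m) t0)) _.
  by rewrite lerD// ltW// cP.
have cauchy_c : cauchy (c @ \oo).
  apply/cauchy_exP => e e0.
  have small : \forall n \near \oo, n.+1%:R^-1 < e / 2.
    exact: (near_infty_natSinv_lt (PosNum (half_gt0 e e0))).
  near \oo => n; exists (c n).
  suff : \forall m \near \oo, ball (c n) e (c m) by [].
  near=> m; rewrite -ball_normE /ball_ /=; apply: le_lt_trans (cc n m) _.
  by rewrite [ltRHS](splitr e) ltrD//; [near: n|near: m].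
move/cauchy_cvgP : cauchy_c => /cvg_ex[/= l cl].
exists l; rewrite -w0 mulr0; apply: oscillation_radius_le => //.
apply: far_closed => e e0; rewrite add0r.
have [n [ne nl]] : exists n, n.+1%:R^-1 < e / 2 /\ `|l - c n| < e / 2.
  have e20 : 0 < e / 2 by rewrite divr_gt0.
  near \oo => n; exists n; split.
    by near: n; exact: (near_infty_natSinv_lt (PosNum e20)).
  by near: n; move/cvgrPdist_lt : cl; exact.
apply: le_trans (far_oscillation_radius (c n) t0).
apply: le_lebesgue_outer; apply: sub_far; rewrite (distrC (c n)).
by rewrite [leRHS](splitr e) lerD ?ltW// (lt_trans (cP n)).
Unshelve. all: by end_near. Qed.

End oscillation.

(** * The stopping-time selection *)

Section stopping.
Context (R : realType) (d : nat) (a0 : 'rV[R]_d.+1) (l0 : R).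
Hypothesis l0_gt0 : 0 < l0.
Local Notation mu := (@lebesgue_outer R d.+1).
Local Notation leb := (@lebesgue R d).
Local Notation dcube := (dcube a0 l0).
Local Notation word := (seq {ffun 'I_d.+1 -> bool}).
Implicit Types (u v w : word).
Context (nu t : R) (B : word -> set 'rV[R]_d.+1).
Hypothesis nu_gt0 : 0 < nu.
Hypothesis t_gt0 : 0 < t.
Hypothesis t_lt1 : t < 1.
Hypothesis B_small : forall w,
  (mu (B w `&` dcube w) <= ((1 - nu) * t)%:E * mu (dcube w))%E.

(** [top w] is the selected cube that governs [w]: while one descends the tree, the
    current cube takes over as soon as more than the portion [t] of it is bad for
    the cube that governs its parent. The selected cubes are the ones that govern
    themselves. *)
Fixpoint top w : word :=
  if w is e :: w' then
    if (t%:E * mu (dcube w) < mu (B (top w') `&` dcube w))%E then w else top w'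
  else [::].

Definition selected : set word := [set w | top w = w].

Lemma top_suffix w : exists u, w = u ++ top w.
Proof.
elim: w => [|e w [u IH]]; first by exists [::].
rewrite /=; case: ifP => _; first by exists [::].
by exists (e :: u); rewrite /= -IH.
Qed.

Lemma top_cons e w : top (e :: w) = e :: w \/ top (e :: w) = top w.
Proof. by rewrite /=; case: ifP => _; [left|right]. Qed.

Lemma size_top w : (size (top w) <= size w)%N.
Proof. by have [u {2}->] := top_suffix w; rewrite size_cat leq_addl. Qed.

Lemma size_top_cat u w : (size (top w) <= size (top (u ++ w)))%N.
Proof.
elim: u => [//|e u IH] /=; case: ifP => _ //.
by rewrite (leq_trans (size_top w))//= size_cat leqW// leq_addl.
Qed.

(** Heavy cubes are selected at once, and a selected cube is light for its own bad
    set by [B_small]. *)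
Lemma top_light w : (mu (B (top w) `&` dcube w) <= t%:E * mu (dcube w))%E.
Proof.
have small v : (mu (B v `&` dcube v) <= t%:E * mu (dcube v))%E.
  apply: le_trans (B_small v) _; apply: lee_wpmul2r; first exact: lebesgue_outer_ge0.
  by rewrite lee_fin ler_piMl ?(ltW t_gt0)// lerBlDr lerDl ltW.
case: w => [|e w]; first exact: small.
rewrite /=; case: ifPn => [_|]; first exact: small.
by rewrite -leNgt.
Qed.

(** The maximal selected cubes strictly inside a selected cube. *)
Definition stopping_children v : set word :=
  [set w | exists e w', [/\ w = e :: w', top w' = v & top w = w]].

Definition core v : set 'rV[R]_d.+1 :=
  dcube v `\` \bigcup_(w in stopping_children v) dcube w.

Lemma stopping_child_size v w : stopping_children v w -> (size v < size w)%N.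
Proof. by move=> [e [w' [-> <- _]]]; rewrite /= ltnS size_top. Qed.

Lemma stopping_child_sub v w : stopping_children v w -> dcube w `<=` dcube v.
Proof.
move=> [e [w' [-> <- _]]]; have [u w'E] := top_suffix w'.
by rewrite [in X in X `<=` _]w'E -cat_cons; exact: dcube_cat_sub.
Qed.

(** Of two nested stopping children the smaller one would have a parent that lies
    in the larger one, hence is governed by a cube at least as deep as the larger
    one, and not by [v]. *)
Lemma trivIset_stopping_children v : trivIset (stopping_children v) dcube.
Proof.
have aux w1 w2 x : stopping_children v w1 -> stopping_children v w2 ->
    (size w1 <= size w2)%N -> dcube w1 x -> dcube w2 x -> w1 = w2.
  move=> C1 [e [w' [-> w'v _]]] s12 x1 x2.
  have [[//|e' u] [_ w'E]] := dcube_nested l0_gt0 s12 x1 x2.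
  have w1S : top w1 = w1 by case: C1 => [e1 [w1' []]].
  by have := size_top_cat u w1; rewrite w1S -w'E w'v leqNgt stopping_child_size.
move=> w1 w2 C1 C2 [x [x1 x2]].
by case: (leqP (size w1) (size w2)) => [s|/ltnW s]; [|apply/esym];
  apply: (aux _ _ x).
Qed.

Lemma core_sub v : core v `<=` dcube v.
Proof. by move=> x []. Qed.

Lemma measurable_core v : cmeasurable (core v).
Proof.
apply: measurableD; first exact: measurable_dcube.
by apply: measurable_bigcup_countType => w _; exact: measurable_dcube.
Qed.

(** More than the portion [t] of each stopping child is bad for [v], while the bad
    set of [v] has the share at most [(1 - nu) * t] of the cube: the quotient of
    the two portions is [1 - nu]. *)
Lemma stopping_children_small v :
  (mu (\bigcup_(w in stopping_children v) dcube w) <=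
    (1 - nu)%:E * mu (dcube v))%E.
Proof.
have ti0 : 0 <= t^-1 by rewrite invr_ge0 ltW.
have mC w : stopping_children v w -> cmeasurable (dcube w).
  by move=> _; exact: measurable_dcube.
have heavy w : stopping_children v w ->
    (mu (setT `&` dcube w) <= (t^-1)%:E * mu (B v `&` dcube v `&` dcube w))%E.
  move=> Cw; rewrite setTI -setIA (setIidr (stopping_child_sub Cw)).
  case: Cw => [e [w' [-> w'v]]] /=; case: ifPn => [+ _|_ top_w']; last first.
    by have := size_top w'; rewrite top_w' ltnn.
  rewrite w'v -(fineK (dcube_fin _ _ _)) => h.
  rewrite muleC lee_pdivlMr// muleC; exact: ltW.
have := piecewise_le ti0 mC (@trivIset_stopping_children v) heavy.
rewrite setTI => /le_trans; apply.
apply: (@le_trans _ _ ((t^-1)%:E * mu (B v `&` dcube v))%E).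
  apply: lee_wpmul2l; first by rewrite lee_fin.
  by apply: le_lebesgue_outer; exact: subIsetl.
apply: (le_trans (lee_wpmul2l _ (B_small v))); first by rewrite lee_fin.
by rewrite muleA -EFinM mulrCA mulVf ?mulr1// gt_eqF.
Qed.

Lemma core_large v : (nu%:E * mu (dcube v) <= mu (core v))%E.
Proof.
set U := \bigcup_(w in stopping_children v) dcube w.
have mU : cmeasurable U.
  by apply: measurable_bigcup_countType => w _; exact: measurable_dcube.
have vU : mu (dcube v) = (mu U + mu (core v))%E.
  rewrite [LHS](mU (dcube v)) [X in OuterMeasure.sort _ X]setIidr//.
  by move=> x [w /stopping_child_sub]; exact.
have := stopping_children_small v; rewrite -/U.
have fcore : mu (core v) \is a fin_num.
  rewrite ge0_fin_numE ?lebesgue_outer_ge0//.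
  by apply: le_lt_trans (dcube_lty a0 l0 v); apply: le_lebesgue_outer; exact: core_sub.
have fU : mu U \is a fin_num.
  rewrite ge0_fin_numE ?lebesgue_outer_ge0//.
  apply: le_lt_trans (dcube_lty a0 l0 v); apply: le_lebesgue_outer.
  by move=> x [w /stopping_child_sub]; exact.
move: vU; rewrite -(fineK fcore) -(fineK fU) -(fineK (dcube_fin a0 l0 v)).
by rewrite -EFinD -!EFinM !lee_fin => -[]; lra.
Qed.

Lemma core_top u v x : selected v -> core v x -> dcube (u ++ v) x ->
  top (u ++ v) = v.
Proof.
move=> Sv [xv nx]; elim: u => [//|e u IH] xeu.
have xu : dcube (u ++ v) x by exact: (@dcube_cat_sub _ _ _ _ l0_gt0 [:: e]).
have [tE|->] := top_cons e (u ++ v); last exact: IH.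
exfalso; apply: nx; exists (e :: (u ++ v)) => //.
by exists e, (u ++ v); split => //; exact: IH.
Qed.

Lemma trivIset_core : trivIset selected core.
Proof.
have aux v w x : selected v -> selected w -> (size v <= size w)%N ->
    core v x -> core w x -> v = w.
  move=> Sv Sw vw xv xw; have [u wE] := dcube_nested l0_gt0 vw (core_sub xv) (core_sub xw).
  by rewrite -[RHS]Sw wE (core_top Sv xv)// -wE; exact: core_sub.
move=> v w Sv Sw [x [xv xw]].
by case: (leqP (size v) (size w)) => [s|/ltnW s]; [|apply/esym];
  apply: (aux _ _ x).
Qed.

(** A cube of later generation that meets the core of [v] is governed by [v], hence
    light: the bad part of the core fills at most the portion [t] of it. *)
Lemma core_bad_null v : selected v -> mu (B v `&` core v) = 0%E.
Proof.
move=> Sv; apply: (@sparse_null _ _ a0 l0 l0_gt0 _ (size v) t); first by rewrite t_lt1 ltW.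
  by move=> x [_ /core_sub xv]; rewrite -dcube0; apply: (@dcube_cat_sub _ _ _ _ l0_gt0 v); rewrite cats0.
move=> w vw; have [->|/set0P[x [[Bx xv] xw]]] := eqVneq (B v `&` core v `&` dcube w) set0.
  by rewrite lebesgue_outer0 mule_ge0 ?lebesgue_outer_ge0// lee_fin ltW.
have [u wE] := dcube_nested l0_gt0 vw (core_sub xv) xw.
have wv : top w = v by rewrite wE (core_top Sv xv)// -wE.
rewrite -[X in B X]wv; apply: le_trans (top_light w); apply: le_lebesgue_outer.
by apply: setSI; rewrite wv; exact: subIsetl.
Qed.

(** The disjoint cores carry the share [nu] of their cubes, so they bound the total
    measure of the selected cubes. *)
Lemma selected_finite_sum :
  (\sum_(0 <= k <oo) mu (pickled selected dcube k) < +oo)%E.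
Proof.
have mcore v : selected v -> cmeasurable (core v) by move=> _; exact: measurable_core.
have := caratheodory_sum_le setT mcore trivIset_core; rewrite setTI => sum_core.
have {}sum_core : (\sum_(0 <= k <oo) mu (setT `&` pickled selected core k) < +oo)%E.
  apply: le_lt_trans sum_core _; apply: le_lt_trans (dcube_lty a0 l0 [::]).
  apply: le_lebesgue_outer => x [v _ /core_sub xv].
  by apply: (@dcube_cat_sub _ _ _ _ l0_gt0 v); rewrite cats0.
apply: (@le_lt_trans _ _ ((nu^-1)%:E *
    \sum_(0 <= k <oo) mu (setT `&` pickled selected core k))%E); last first.
  have : (0 <= \sum_(0 <= k <oo) mu (setT `&` pickled selected core k))%E.
    by apply: nneseries_ge0 => k _ _; exact: lebesgue_outer_ge0.
  move: sum_core; case: (\sum_(0 <= k <oo) _)%E => // s _ _.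
  by rewrite -EFinM ltry.
rewrite -nneseriesZl; last by move=> k _; exact: lebesgue_outer_ge0.
apply: lee_nneseries => k _; first by move=> _; exact: lebesgue_outer_ge0.
have [->|[v Sv [_ vE]]] := pickledP selected dcube k.
  by rewrite lebesgue_outer0 mule_ge0 ?lebesgue_outer_ge0// lee_fin invr_ge0 ltW.
rewrite !vE setTI -(fineK (dcube_fin a0 l0 v)) muleC lee_pdivlMr//.
by rewrite fineK ?dcube_fin// muleC; exact: core_large.
Qed.

(** By the Borel-Cantelli lemma almost every point lies in finitely many selected
    cubes; it is in the core of the smallest of them. *)
Lemma ae_exists_core : exists2 N, mu N = 0%E &
  forall x, cube a0 l0 x -> ~ N x -> exists2 v, selected v & core v x.
Proof.
exists (lim_sup_set (pickled selected dcube)).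
  apply: (@lim_sup_set_cvg0 _ _ _ leb _ _ selected_finite_sum).
  by apply: measurable_pickled => v _; exact: measurable_dcube.
move=> x x0 Nx.
have [n xn] : exists n, forall v, selected v -> dcube v x -> (pickle v < n)%N.
  apply: contrapT => /forallNP no; apply: Nx => n _.
  have /existsNP[v /not_implyP[Sv /not_implyP[xv]]] := no n.
  by move=> /negP; rewrite -leqNgt => nv; exists (pickle v) => //; exists v.
pose P m := `[< exists v, [/\ selected v, dcube v x & size v = m] >].
have P0 : exists m, P m.
  by exists 0%N; apply/asboolP; exists [::]; rewrite dcube0.
have Pbound m : P m -> (m <= \max_(j < n) size (odflt [::] (@unpickle word j)))%N.
  move=> /asboolP[v [Sv xv <-]].
  apply: (@leq_trans (size (odflt [::] (@unpickle word (pickle v))))).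
    by rewrite pickleK.
  exact: (@leq_bigmax _ (fun j : 'I_n => size (odflt [::] (@unpickle word j)))
    (Ordinal (xn v Sv xv))).
case: (ex_maxnP P0 Pbound) => m /asboolP[v [Sv xv vm]] m_max.
exists v => //; split=> // -[w Cw xw].
have := stopping_child_size Cw; rewrite vm ltnNge => /negP; apply; apply: m_max.
by apply/asboolP; exists w; split => //; case: Cw => [e [w' []]].
Qed.

End stopping.

(** * Chaining the centers *)

Section chain.
Context (R : realType) (d : nat) (E : completeNormedModType R).
Context (f : 'rV[R]_d.+1 -> E) (a0 : 'rV[R]_d.+1) (l0 : R) (nu : R).
Hypothesis l0_gt0 : 0 < l0.
Local Notation mu := (@lebesgue_outer R d.+1).
Local Notation dcube := (dcube a0 l0).
Local Notation word := (seq {ffun 'I_d.+1 -> bool}).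
Implicit Types (u v w : word).
Hypothesis Q0_gt0 : (0 < mu (cube a0 l0))%E.
Hypothesis nu_gt0 : 0 < nu.
Local Notation t := (2 ^- (d.+1 + 2) : R).
Context (c : word -> E) (r : word -> R).
Hypothesis r_ge0 : forall w, 0 <= r w.
Hypothesis far_c : forall w,
  (mu (far f (dcube w) (c w) (r w)) <= ((1 - nu) * t)%:E * mu (dcube w))%E.

Definition outside w : set 'rV[R]_d.+1 := ~` (f @^-1` closed_ball_ Num.norm (c w) (r w)).

Lemma far_outside w Q : far f Q (c w) (r w) = outside w `&` Q.
Proof. by rewrite setIC. Qed.

Lemma outside_small w :
  (mu (outside w `&` dcube w) <= ((1 - nu) * t)%:E * mu (dcube w))%E.
Proof. by rewrite -far_outside. Qed.

Local Notation top := (top a0 l0 t outside).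
Local Notation selected := (selected a0 l0 t outside).

Lemma threshold_gt0 : 0 < t.
Proof. by rewrite invr_gt0 exprn_gt0. Qed.

Lemma threshold_lt_quarter : t < 4^-1.
Proof.
rewrite ltf_pV2 ?posrE ?exprn_gt0//.
have -> : 4 = 2 ^+ 2 :> R by ring.
by rewrite ltr_eXn2l ?ltr1n// addn2 ltnS ltnS.
Qed.

(** The threshold is chosen so that light cubes remain light, with portion [1/4],
    after one more subdivision. *)
Lemma quarter_child e w : (t%:E * mu (dcube w) = 4^-1%:E * mu (dcube (e :: w)))%E.
Proof.
rewrite (lebesgue_outer_dcube_cons _ l0_gt0 e) muleA -EFinM; congr (_%:E * _)%E.
by rewrite exprD invfM mulrAC mulVf ?mul1r ?expf_neq0//; congr (_^-1); ring.
Qed.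

(** The cube of [w] is light for the cube that governs it. Hence the ball of the
    governing cube misses at most a quarter of the child, and the ball of the child
    misses less than three quarters of it: the two balls meet. *)
Lemma center_step e w : `|c (top w) - c (e :: w)| <= r (top w) + r (e :: w).
Proof.
have lam : 4^-1 + (1 - nu) * t < 1.
  have : (1 - nu) * t <= t by rewrite ler_piMl ?(ltW threshold_gt0)// lerBlDr lerDl ltW.
  by have := threshold_lt_quarter; lra.
apply: (balls_meet (dcube_fin _ _ _) (dcube_gt0 _ _ (e :: w)) lam _ (far_c (e :: w))) => //.
rewrite -quarter_child far_outside.
apply: le_trans (top_light nu_gt0 threshold_gt0 outside_small w).
apply: le_lebesgue_outer; apply: setIS.
exact: (@dcube_cat_sub _ _ _ _ l0_gt0 [:: e]).
Qed.

Fixpoint ancestors w : seq word :=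
  if w is e :: w' then
    if top w == w then w :: ancestors w' else ancestors w'
  else [:: [::]].

Lemma ancestors_cons e w : ancestors (e :: w) =
  if top (e :: w) == e :: w then (e :: w) :: ancestors w else ancestors w.
Proof. by []. Qed.

Lemma ancestors_suffix w v : v \in ancestors w -> selected v /\ exists u, w = u ++ v.
Proof.
elim: w => [|e w IH] /=; first by rewrite inE => /eqP ->; split => //; exists [::].
have {}IH : v \in ancestors w -> selected v /\ exists u, e :: w = u ++ v.
  by move=> /IH[Sv [u ->]]; split => //; exists (e :: u).
case: eqP => // tw; rewrite inE => /predU1P[->|//].
by split => //; exists [::].
Qed.

Lemma uniq_dcube_ancestors w : uniq (map dcube (ancestors w)).
Proof.
elim: w => [//|e w IH] /=; case: ifP => //= _; rewrite IH andbT.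
apply/mapP => -[v /ancestors_suffix[_ [u wE]]] /esym.
apply: dcube_size_neq => //.
by rewrite wE /= ltnS size_cat leq_addl.
Qed.

(** Each [r v] is paid twice, as the radius of the ball that is left and of the one
    that is entered. The extra terms [r (top w)] and [r [::]] make the induction
    work: the former is the half of the next step that is already paid. *)
Lemma center_chain w :
  `|c [::] - c (top w)| + r (top w) + r [::] <= 2 * \sum_(v <- ancestors w) r v.
Proof.
elim: w => [|e w IH].
  by rewrite /= big_seq1 subrr normr0 add0r mulr_natl mulr2n.
rewrite ancestors_cons; have [tE|tE] := top_cons a0 l0 t outside e w.
  rewrite tE eqxx big_cons; have := center_step e w.
  have := ler_distD (c (top w)) (c [::]) (c (e :: w)); lra.
case: eqP => [ttE|_]; last by rewrite tE.
rewrite big_cons tE; have := r_ge0 (e :: w); lra.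
Qed.

Lemma ancestors_nil w : [::] \in ancestors w.
Proof.
by elim: w => [|e w IH] /=; [rewrite inE|case: ifP => // _; rewrite inE IH orbT].
Qed.

Lemma pointwise_domination v x c0 : selected v -> ~ outside v x ->
  `|c [::] - c0| <= 3 * r [::] ->
  `|f x - c0| <= 4 * \sum_(w <- ancestors v) r w.
Proof.
move=> Sv /contrapT fx cc0; have := center_chain v; rewrite Sv => chain.
rewrite /closed_ball_/= in fx.
have r0_le : r [::] <= \sum_(w <- ancestors v) r w.
  by rewrite (big_rem _ (ancestors_nil v))/= lerDl; apply: sumr_ge0.
have := ler_distD (c [::]) (f x) c0; have := ler_distD (c v) (f x) (c [::]).
rewrite (distrC (f x) (c v)) (distrC (c v) (c [::])); lra.
Qed.

End chain.

Lemma dyadic_domination (R : realType) (d : nat) (E : completeNormedModType R) (nu : R)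
    (f : 'rV[R]_d.+1 -> E) (a0 : 'rV[R]_d.+1) (l0 : R) :
  0 < nu < 1 -> strongly_measurable f -> 0 < l0 ->
  (0 < lebesgue_outer (cube a0 l0))%E ->
  exists S : set (set 'rV[R]_d.+1),
    [/\ forall Q, S Q -> dyadic_subcube (cube a0 l0) Q,
        nearly_disjoint nu S &
        exists N : set 'rV[R]_d.+1, lebesgue_outer N = 0%E /\
          forall x, cube a0 l0 x -> ~ N x ->
          forall c : E, quasi_optimal_center 4^-1 f (cube a0 l0) c ->
            (`|f x - c|%:E <=
             12%:E * \esum_(Q in S)
               (oscillation ((1 - nu) * 2 ^- (d.+1 + 2)) f Q * \1_Q x)%:E)%E].
Proof.
move=> /andP[nu0 nu1] [fm _] l0_gt0 Q0_gt0.
have mball c r : cmeasurable (f @^-1` (closed_ball_ Num.norm c r)).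
  apply: fm => M [[_ MC _] openM]; rewrite -[closed_ball_ _ _ _]setCK -setTD.
  by apply/MC/openM; rewrite /= openC; exact: closed_closed_ball_.
pose t : R := 2 ^- (d.+1 + 2); pose lam := (1 - nu) * t.
have t0 : 0 < t := threshold_gt0 R d.
have t14 : t < 4^-1 := threshold_lt_quarter R d.
have t1 : t < 1 by lra.
have lam0 : 0 < lam by rewrite mulr_gt0// subr_gt0.
have lam14 : lam < 4^-1.
  by apply: le_lt_trans t14; rewrite ler_piMl ?(ltW t0)// lerBlDr lerDl ltW.
pose Q w := dcube a0 l0 w.
have Qm w : cmeasurable (Q w) := measurable_dcube a0 l0 w.
have Qfin w := dcube_fin a0 l0 w.
have Qgt0 w := dcube_gt0 l0_gt0 Q0_gt0 w.
have /choice[c cP] : forall w, exists c, quasi_optimal_center lam f (Q w) c.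
  by move=> w; apply: exists_quasi_optimal_center => //; lra.
pose r w := oscillation_radius lam f (Q w) (c w).
have r0 w : 0 <= r w by exact: oscillation_radius_ge0.
have far_c w : (lebesgue_outer (far f (Q w) (c w) (r w)) <=
    lam%:E * lebesgue_outer (Q w))%E by exact: far_oscillation_radius.
pose B := outside f c r.
have B_small : forall w, (lebesgue_outer (B w `&` Q w) <= lam%:E * lebesgue_outer (Q w))%E.
  exact: outside_small.
pose sel := selected a0 l0 t B.
pose core := core a0 l0 t B.
pose S := [set Q w | w in sel].
(* [nearly_disjoint] asks for a core for each set of the family, while cores are
   attached to words: some selected word of the set is chosen. *)
have SP P : S P -> sel (xget [::] [set w | sel w /\ Q w = P]) /\
    Q (xget [::] [set w | sel w /\ Q w = P]) = P.
  by move=> [w Sw wP]; apply: (@xgetPex _ [::] [set w | sel w /\ Q w = P]); exists w.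
exists S; split.
- by move=> _ [w _ <-]; exact: dyadic_dcube.
- exists (fun P => core (xget [::] [set w | sel w /\ Q w = P])); split.
    move=> P /SP[]; set w := xget _ _ => Sw <-; split.
    + exact: measurable_core.
    + exact: core_sub.
    + exact: (core_large l0_gt0 t0 B_small).
  move=> P P' /SP[Sw wP] /SP[Sw' wP'] PP'; apply/seteqP; split=> // x xww'.
  apply: PP'; rewrite -wP -wP'; congr Q.
  by apply: (trivIset_core l0_gt0 Sw Sw'); exists x.
have [N N0 Ncore] := ae_exists_core l0_gt0 nu0 t0 B_small.
exists (N `|` \bigcup_(v in sel) (B v `&` core v)); split.
  apply/le_anti; rewrite lebesgue_outer_ge0 andbT.
  apply: le_trans (outer_measureU2 _ _ _) _.
  rewrite /= N0 add0e lebesgue_outer_bigcup_null// => v Sv.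
  exact: (core_bad_null l0_gt0 nu0 t0 t1 B_small).
move=> x x0 /not_orP[Nx xB] c0 c0P.
have [v Sv xv] := Ncore x x0 Nx.
have fx : ~ B v x by move=> Bx; apply: xB; exists v.
have xanc w : w \in ancestors f a0 l0 c r v -> Q w x.
  move=> /ancestors_suffix[_ [u vE]]; apply: (@dcube_cat_sub _ _ _ _ l0_gt0 u).
  by rewrite -vE; exact: core_sub xv.
(* The given center is compared with [c [::]]: its radius at the portion [1/4] is
   at most twice the oscillation at [1/4], hence at most [2 * r [::]]. *)
have cc0 : `|c [::] - c0| <= 3 * r [::].
  rewrite -(dcube0 a0 l0) -/(Q [::]) in c0P.
  have quarter0 : 0 < 4^-1 :> R by rewrite invr_gt0.
  have lam1 : lam + 4^-1 < 1 by lra.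
  apply: le_trans (balls_meet (Qfin [::]) (Qgt0 [::]) lam1 (far_c [::])
    (far_oscillation_radius mball (Qm _) (Qfin _) (Qgt0 _) c0 quarter0)) _.
  have -> : 3 * r [::] = r [::] + 2 * r [::] by ring.
  rewrite lerD2l (le_trans c0P)// ler_pM2l//.
  apply: le_trans (oscillation_le_radius mball (Qm _) (Qfin _) (Qgt0 _) (c [::]) quarter0) _.
  apply: oscillation_radius_le => //; apply: le_trans (far_c _) _.
  by apply: lee_wpmul2r; rewrite ?lebesgue_outer_ge0// lee_fin ltW.
have fxc := pointwise_domination l0_gt0 Q0_gt0 nu0 r0 far_c Sv fx cc0.
pose anc := ancestors f a0 l0 c r v.
have osc0 w : 0 <= oscillation lam f (Q w) by exact: oscillation_ge0.
apply: (@le_trans _ _ (12%:E * \sum_(P <- map Q anc)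
    (oscillation lam f P * \1_P x)%:E)%E).
  rewrite big_map sumEFin -EFinM lee_fin (le_trans fxc)//.
  (* [r w <= 2 * oscillation], and [4 * 2 <= 12] *)
  rewrite (_ : 12 = 4 * 3)//; last by ring.
  rewrite -mulrA ler_pM2l// mulr_sumr big_seq [leRHS]big_seq.
  apply: ler_sum => w wanc; rewrite indicE mem_set ?mulr1; last exact: xanc.
  by apply: le_trans (cP w) _; apply: ler_wpM2r => //; lra.
apply: lee_wpmul2l; first by rewrite lee_fin.
apply: esum_ge; exists [set` map Q anc].
  split; first exact: finite_seq.
  by move=> _ /mapP[w /ancestors_suffix[Sw _] ->]; exists w.
by rewrite -fsbig_seq//; exact: uniq_dcube_ancestors.
Qed.

Theorem theorem2p13 (R : realType) (d : nat) (hd : (0 < d)%N)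
    (E : completeNormedModType R) (nu : R) (hnu : 0 < nu < 1)
    (f : 'rV[R]_d -> E) (hf : strongly_measurable f)
    (Q0 : set 'rV[R]_d) (hQ0 : is_cube Q0) :
  exists S : set (set 'rV[R]_d),
    [/\ forall Q, S Q -> dyadic_subcube Q0 Q,
        nearly_disjoint nu S &
        exists N : set 'rV[R]_d, lebesgue_outer N = 0%E /\
          forall x, Q0 x -> ~ N x ->
          forall c : E, quasi_optimal_center 4^-1 f Q0 c ->
            (`|f x - c|%:E <=
             12%:E * \esum_(Q in S)
               (oscillation ((1 - nu) * 2 ^- (d + 2)) f Q * \1_Q x)%:E)%E].
Proof.
case: d hd f hf Q0 hQ0 => [//|d] _ f hf _ [a0 [l0 l0_gt0 ->]].
(* On a null cube the empty family does, with the cube as exceptional set. *)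
have := lebesgue_outer_ge0 (cube a0 l0); rewrite le_eqVlt.
move=> /predU1P[Q0_null|Q0_gt0]; last exact: dyadic_domination.
exists set0; split => //; last by exists (cube a0 l0); split => // x ? [].
by exists (fun=> set0); split.
Qed.
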